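(* Consider a finite absorbing Markov chain with state space $V$ and set of absorbing states $U\subseteq V$, let $v\in V\setminus U$, and let $u\in U$. Let $\mathbf{v}^{(N)}$ be the firing vector after $N$ steps of a hunger game process (with arbitrary initial hunger vector) on the rerouted Markov chain associated with $v$. Define $$a_N=\frac{\mathbf{v}^{(N)}_u}{\sum_{u'\in U}\mathbf{v}^{(N)}_{u'}},$$ with $a_N$ defined to be $0$ when the denominator equals $0$. Then $a_N$ converges to the hitting probability $h_u(v)$ with discrepancy $O(1/N)$; that is, there exists a constant $C$ such that $|a_N-h_u(v)|\le \frac{C}{N}$ for all $N\ge 1$.
   Context: A state $k$ is absorbing if $P_{kk}=1$. A Markov chain is absorbing if from each state there is a path of finite length (with positive transition probabilities) to an absorbing state. For $u\in U$, the hitting probability is $h_u(v)=\mathbb{P}_v(X_t=u \text{ for all sufficiently large } t)$, where $\mathbb{P}_v$ is the law of the chain $X_0,X_1,\dots$ started at $X_0=v$. The rerouted Markov chain associated with $v$ is obtained from the original chain by replacing, for each $u\in U$, the row $P_u$ of the transition matrix by the unit vector $e_v$ (so every absorbing state now moves to $v$ with probability 1), and then deleting all states that cannot be reached from $v$ with positive probability. For a state $u'$ that has been deleted, $\mathbf{v}^{(N)}_{u'}$ is taken to be $0$. Hunger game process on a finite chain with transition matrix $P$ and totally ordered (indexed) states: let $H=P-I$ with rows $H_i$. At each step, let $i$ be the lowest-indexed state at which the hunger vector $\mathbf{h}$ attains its maximum, and replace $\mathbf{h}$ by $\mathbf{h}+H_i$; the chip is said to fire to $i$. The firing vector $\mathbf{v}^{(N)}$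 after $N$ steps has $i$-th component equal to the number of those steps at which the chip fired to $i$. *)

(* Defs.v *)
From mathcomp Require Import all_boot all_order all_algebra.
From mathcomp Require Import all_classical all_reals all_analysis.

Set Implicit Arguments.
Unset Strict Implicit.
Unset Printing Implicit Defensive.

Import Order.TTheory GRing.Theory Num.Theory.
Import numFieldNormedType.Exports.

Local Open Scope classical_set_scope.
Local Open Scope ring_scope.

Section MarkovChain.
Variables (R : realType) (S : finType).
Implicit Type P : S -> S -> R.

Definition stochastic P : Prop :=
  (forall x y, 0 <= P x y) /\ (forall x, \sum_y P x y = 1).

Definition pos_step P : rel S := fun x y => 0 < P x y.

Definition is_absorbing P : pred S := fun k => P k k == 1.

Definition absorbing_chain P : Prop :=
  stochastic P /\
  forall x, exists2 k, is_absorbing P k & connect (pos_step P) x k.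

(* [S] carries the discrete sigma-algebra, so measurability of [X t] amounts to
   measurability of the fibres of [X t]; the law of the chain is given by the
   probabilities of all finite initial trajectories. *)
Definition markov_chain_from P (v : S) d (Omega : measurableType d)
    (Pr : probability Omega R) (X : nat -> Omega -> S) : Prop :=
  (forall t x, measurable (X t @^-1` [set x])) /\
  (forall (t : nat) (x : nat -> S),
     Pr [set w | forall s, (s <= t)%N -> X s w = x s] =
     ((x 0%N == v)%:R * \prod_(s < t) P (x s) (x s.+1))%:E).

Definition hitting_probability d (Omega : measurableType d)
    (Pr : probability Omega R) (X : nat -> Omega -> S) (u : S) : R :=
  fine (Pr [set w | \forall t \near \oo, X t w = u]).

End MarkovChain.

Section HungerGame.
Variables (R : realType) (S : finType).
(* The total order on the states is the one induced by an injective index. *)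
Variables (idx : S -> nat) (P : S -> S -> R).
Implicit Type h : S -> R.

Definition hunger_row (i : S) : S -> R := fun j => P i j - (i == j)%:R.

Definition is_hungriest h : pred S := fun i => [forall j, h j <= h i].

(* [None] only when [S] is empty; when [idx] is injective at most one [i]
   qualifies. *)
Definition chip h : option S :=
  [pick i | is_hungriest h i &
            [forall j, is_hungriest h j ==> (idx i <= idx j)%N]].

Definition hunger_step h : S -> R :=
  if chip h is Some i then fun j => h j + hunger_row i j else h.

Definition hunger h0 (t : nat) : S -> R := iter t hunger_step h0.

Definition firing_vector h0 (N : nat) (i : S) : nat :=
  (\sum_(t < N) (chip (hunger h0 t) == Some i))%N.

End HungerGame.

Section Rerouted.
Variables (R : realType) (V : finType) (P : V -> V -> R) (v : V).

Definition reroute (x y : V) : R :=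
  if is_absorbing P x then (y == v)%:R else P x y.

Definition rerouted_state : finType :=
  {x : V | connect (pos_step reroute) v x}.

Definition rerouted (x y : rerouted_state) : R := reroute (val x) (val y).

Definition rerouted_firing (idx : rerouted_state -> nat)
    (h0 : rerouted_state -> R) (N : nat) (x : V) : nat :=
  if (insub x : option rerouted_state) is Some s
  then firing_vector idx rerouted h0 N s else 0%N.

(* When the denominator vanishes, so does the quotient, as [0^-1 = 0]. *)
Definition absorption_ratio (idx : rerouted_state -> nat)
    (h0 : rerouted_state -> R) (u : V) (N : nat) : R :=
  (rerouted_firing idx h0 N u)%:R /
  (\sum_(u' | is_absorbing P u') rerouted_firing idx h0 N u')%N%:R.

End Rerouted.

(* Main.v *)
Require Import Defs.
From mathcomp Require Import all_boot all_order all_algebra.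
From mathcomp Require Import all_classical all_reals all_analysis.
From mathcomp Require Import ring lra.
Import Order.TTheory GRing.Theory Num.Theory.
Import numFieldNormedType.Exports.
Local Open Scope classical_set_scope.
Local Open Scope ring_scope.

Set Implicit Arguments.
Unset Strict Implicit.

(* Each step changes the hunger vector by a row of Q - I, where Q is the rerouted
   matrix, so pairing with a function phi gives
     sum_j (h_N - h_0)_j phi_j = sum_i f_i (Q phi - phi)_i,   f the firing vector.
   The left-hand side is bounded in N because hunger vectors stay bounded. Take phi
   to be the probability g of absorption at u: g is P-harmonic, so only absorbing
   states contribute and f_u - g(v) sum_U f is bounded. Take phi = tau with
   tau = 0 on U and P tau <= tau - 1 elsewhere: N - (1 + tau(v)) sum_U f is bounded
   above, so sum_U f grows linearly, and dividing yields the O(1/N) rate. *)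

(** * The transition operator on functions: absorption probabilities and a drift function *)

Section Transition.
Variables (R : realType) (S : finType).
Implicit Types (P : S -> S -> R) (phi psi : S -> R).

Definition transition P phi : S -> R := fun x => \sum_y P x y * phi y.

Lemma transition_le P phi psi : stochastic P ->
  (forall x, phi x <= psi x) -> forall x, transition P phi x <= transition P psi x.
Proof.
by move=> [P0 _] le x; apply: ler_sum => y _; rewrite ler_wpM2l.
Qed.

Lemma iter_transition_le P phi psi n : stochastic P ->
  (forall x, phi x <= psi x) ->
  forall x, iter n (transition P) phi x <= iter n (transition P) psi x.
Proof. by move=> sP le; elim: n => //= n IHn; apply: transition_le. Qed.

Lemma iter_transition_cst P c n x : stochastic P ->
  iter n (transition P) (fun=> c) x = c.
Proof.
move=> [_ P1]; elim: n x => //= n IHn x; rewrite /transition.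
by under eq_bigr do rewrite IHn; rewrite -mulr_suml P1 mul1r.
Qed.

Lemma iter_transition_nondecreasing P phi m n x : stochastic P ->
  (forall y, phi y <= transition P phi y) -> (m <= n)%N ->
  iter m (transition P) phi x <= iter n (transition P) phi x.
Proof.
move=> sP le /subnK <-; elim: (n - m)%N => // k /le_trans; apply.
by rewrite addSn iterSr; apply: iter_transition_le.
Qed.

Lemma transition_absorbing P phi k : stochastic P -> is_absorbing P k ->
  transition P phi k = phi k.
Proof.
move=> [P0 P1] /eqP Pkk; rewrite /transition (bigD1 k)//= Pkk mul1r.
rewrite big1 ?addr0// => y yk; have := P1 k; rewrite (bigD1 k)//= Pkk => /eqP.
rewrite -subr_eq0 addrAC subrr add0r psumr_eq0 // => /allP/(_ y (mem_index_enum y)).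
by rewrite yk /= => /eqP ->; rewrite mul0r.
Qed.

Lemma iter_transition_absorbing P phi n k : stochastic P -> is_absorbing P k ->
  iter n (transition P) phi k = phi k.
Proof. by move=> sP ak; elim: n => //= n IHn; rewrite transition_absorbing. Qed.

(** Equality holds on [A], whose states are absorbing, and the left side vanishes elsewhere. Hence
    the iterates of the indicator grow with time. *)
Lemma indicator_subharmonic P (A : pred S) x : stochastic P ->
  {subset A <= is_absorbing P} -> (x \in A)%:R <= transition P (fun y => (y \in A)%:R) x.
Proof.
move=> sP sA; have [xA|_] := boolP (x \in A).
  by rewrite transition_absorbing ?xA //; apply: sA.
by apply: sumr_ge0 => y _; rewrite mulr_ge0 ?ler0n // sP.1.
Qed.

Lemma iter_indicator_bound P (A : pred S) n x : stochastic P ->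
  0 <= iter n (transition P) (fun y => (y \in A)%:R) x <= 1.
Proof.
move=> sP; apply/andP; split.
  rewrite -[leLHS](iter_transition_cst 0 n x sP).
  by apply: iter_transition_le => // y; case: (y \in A).
rewrite -[leRHS](iter_transition_cst 1 n x sP).
by apply: iter_transition_le => // y; case: (y \in A).
Qed.

(** The iterate is the probability of absorption by time [n]: positive when [n] is the length of a
    path to an absorbing state, and nondecreasing in [n]. The largest of finitely many path lengths
    therefore serves every state. *)
Lemma iter_absorbed_gt0 P : absorbing_chain P ->
  exists n, forall x, 0 < iter n (transition P) (fun y => (is_absorbing P y)%:R) x.
Proof.
move=> [sP reach].
have le y : (is_absorbing P y)%:R <= transition P (fun y => (is_absorbing P y)%:R) y.
  exact: (@indicator_subharmonic P (is_absorbing P)).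
have /choice[N N_gt0] x :
    exists n, 0 < iter n (transition P) (fun y => (is_absorbing P y)%:R) x.
  have [k ak /connectP[p pth def_k]] := reach x; exists (size p).
  elim: p x pth def_k => [|y p IHp] x /=; first by move=> _ <-; rewrite ak.
  move=> /andP[xy pth] /(IHp _ pth) gt0; rewrite /transition (bigD1 y)//=.
  apply: ltr_wpDr; last exact: mulr_gt0.
  apply: sumr_ge0 => z _; apply: mulr_ge0; first exact: sP.1.
  by have /andP[] := @iter_indicator_bound P (is_absorbing P) (size p) z sP.
exists (\max_x N x)%N => x; apply: (lt_le_trans (N_gt0 x)).
by apply: iter_transition_nondecreasing => //; apply: leq_bigmax.
Qed.

(* With m such that absorption within m steps has positive probability from every
   state, tau is a multiple of sum_(n < m) P(not absorbed by time n), a truncated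
   expected absorption time; truncation avoids convergence questions. *)
Lemma lyapunov_exists P : absorbing_chain P ->
  exists tau : S -> R, [/\ forall x, 0 <= tau x,
    forall x, is_absorbing P x -> tau x = 0 &
    forall x, ~~ is_absorbing P x -> transition P tau x <= tau x - 1].
Proof.
move=> aP; have [sP _] := aP; have [m b_gt0] := iter_absorbed_gt0 aP.
pose b n := iter n (transition P) (fun y => (is_absorbing P y)%:R).
have b01 n x : 0 <= b n x <= 1 by exact: (@iter_indicator_bound P (is_absorbing P)).
(* The factor [K] makes [K * b m x] at least 1 at every state; this product is the decrease of [tau]
   in one step. *)
pose K := \sum_x (b m x)^-1.
have K_ge x : (b m x)^-1 <= K.
  rewrite /K (bigD1 x)//= lerDl sumr_ge0// => y _.
  by rewrite invr_ge0; case/andP: (b01 m y).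
have K0 : 0 <= K by apply: sumr_ge0 => y _; rewrite invr_ge0; case/andP: (b01 m y).
exists (fun x => K * \sum_(n < m) (1 - b n x)); split=> [x|x ax|x nax].
- rewrite mulr_ge0// sumr_ge0// => n _.
  by rewrite subr_ge0; case/andP: (b01 n x).
- by rewrite big1 ?mulr0// => n _; rewrite /b iter_transition_absorbing // ax subrr.
have -> : transition P (fun y => K * \sum_(n < m) (1 - b n y)) x =
    K * \sum_(n < m) (1 - b n.+1 x).
  rewrite /transition; under eq_bigr do rewrite mulrCA mulr_sumr.
  rewrite -mulr_sumr exchange_big; congr (_ * _); apply: eq_bigr => n _ /=.
  under eq_bigr do rewrite mulrBr mulr1.
  by rewrite sumrB sP.2.
(* The difference telescopes to [b m x - b 0 x], and [b 0 x] is zero off the absorbing states. *)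
have -> : \sum_(n < m) (1 - b n.+1 x) = \sum_(n < m) (1 - b n x) - b m x.
  have b0 : b 0 x = 0 by rewrite /b /= (negbTE nax).
  have -> : b m x = b m x - b 0 x by rewrite b0 subr0.
  rewrite -(telescope_sumr (fun n => b n x)) // big_mkord.
  by rewrite -sumrB; apply: eq_bigr => n _; ring.
have : (b m x)^-1 * b m x <= K * b m x by rewrite ler_wpM2r// ltW // b_gt0.
by rewrite mulVf ?lt0r_neq0 ?b_gt0// mulrBr => le1; rewrite lerB.
Qed.

(** Here [g x] is the probability of absorption in [A] from [x]. The iterates are nondecreasing and
    lie between 0 and 1, so they converge; the sequence shifted by one step has the same limit,
    which makes [g] harmonic. *)
Lemma harmonic_limit P (A : pred S) : stochastic P ->
  {subset A <= is_absorbing P} ->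
  exists g : S -> R, [/\
    forall x, (fun n => iter n (transition P) (fun y => (y \in A)%:R) x) @ \oo --> g x,
    forall x, 0 <= g x <= 1, forall x, is_absorbing P x -> g x = (x \in A)%:R &
    forall x, transition P g x = g x].
Proof.
move=> sP sA; pose a n := iter n (transition P) (fun y => (y \in A)%:R).
have a01 n x : 0 <= a n x <= 1 by exact: iter_indicator_bound.
have acvg x : (fun n => a n x) @ \oo --> limn (fun n => a n x).
  apply: nondecreasing_is_cvgn.
    move=> m n; apply: iter_transition_nondecreasing => // y.
    exact: indicator_subharmonic.
  by exists 1 => _ [n _ <-]; case/andP: (a01 n x).
exists (fun x => limn (fun n => a n x)); split=> // [x|x ax|x].
- apply/andP; split.
    by apply: limr_ge; [exact: acvg|apply: nearW => n; case/andP: (a01 n x)].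
  by apply: limr_le; [exact: acvg|apply: nearW => n; case/andP: (a01 n x)].
- apply/cvg_lim => //; under eq_fun do rewrite /a iter_transition_absorbing//.
  exact: cvg_cst.
- symmetry; apply/cvg_lim => //; rewrite -(cvg_shiftS (fun n => a n x)) /=.
  rewrite /transition; apply: cvg_big => [|y _].
    exact: add_continuous.
  by apply: cvgM; [exact: cvg_cst|exact: acvg].
Qed.

End Transition.

(** * Hunger vectors: pairing identity, conservation and boundedness *)

Section Hunger.
Variables (R : realType) (S : finType) (idx : S -> nat) (Q : S -> S -> R).
Implicit Types (h phi : S -> R).

Lemma chip_max h i j : chip idx h = Some i -> h j <= h i.
Proof. by rewrite /chip; case: pickP => // k /andP[/forallP + _] [<-]. Qed.

Lemma chip_exists h : S -> exists i, chip idx h = Some i.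
Proof.
move=> x0; rewrite /chip; case: pickP => [i _|none]; first by exists i.
have [m _ m_max] := @arg_maxP _ _ _ x0 xpredT h isT.
have hm : is_hungriest h m by apply/forallP => j; apply: m_max.
have [k hk k_min] := arg_minnP idx hm.
have /negP[] := none k; rewrite hk /=.
by apply/forallP => j; apply/implyP => /k_min.
Qed.

Lemma firing_pairing h0 N (phi : S -> R) : S ->
  \sum_j (hunger idx Q h0 N j - h0 j) * phi j =
  \sum_i (firing_vector idx Q h0 N i)%:R * (transition Q phi i - phi i).
Proof.
move=> x0; elim: N => [|N IHN].
  by rewrite !big1// => i _; rewrite ?subrr ?mul0r// /firing_vector big_ord0 mul0r.
have [i chip_i] := chip_exists (hunger idx Q h0 N) x0.
have -> : \sum_j (hunger idx Q h0 N.+1 j - h0 j) * phi j =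
    \sum_j (hunger idx Q h0 N j - h0 j) * phi j + \sum_j hunger_row Q i j * phi j.
  rewrite -big_split; apply: eq_bigr => j _.
  by rewrite /hunger iterS -/(hunger _ _ _ _) /hunger_step chip_i /=; ring.
have -> : \sum_j hunger_row Q i j * phi j = transition Q phi i - phi i.
  rewrite /hunger_row /transition; under eq_bigr do rewrite mulrBl.
  rewrite sumrB; congr (_ - _); rewrite (bigD1 i)//= eqxx mul1r big1 ?addr0// => j.
  by rewrite eq_sym => /negbTE ->; rewrite mul0r.
have fS j : firing_vector idx Q h0 N.+1 j = (firing_vector idx Q h0 N j + (i == j))%N.
  by rewrite /firing_vector big_ord_recr /= chip_i.
rewrite IHN [in RHS](bigD1 i)//= fS eqxx natrD mulrDl mul1r (bigD1 i)//=.
rewrite addrAC; congr (_ + _).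
by apply: eq_bigr => j; rewrite eq_sym fS => /negbTE ->; rewrite addn0.
Qed.

Hypothesis sQ : stochastic Q.

(* Only firing to i outside A can increase the sum over A. Then h i dominates h on A,
   so the invariant for i |: A leaves room for the increment, which is at most 1. *)
Lemma hunger_sum_le B h0 t : S -> (forall j, h0 j <= B) -> forall A : {set S},
  \sum_(j in A) hunger idx Q h0 t j <= #|A|%:R * (B + #|S|%:R - #|A|%:R).
Proof.
move=> x0 h0B; elim: t => [|t IHt] A.
  apply: (@le_trans _ _ (\sum_(j in A) B)); first exact: ler_sum.
  rewrite sumr_const -[leLHS]mulr_natl ler_wpM2l//.
  have : #|A|%:R <= #|S|%:R :> R by rewrite ler_nat max_card.
  lra.
set h := hunger idx Q h0 t in IHt *.
have -> : hunger idx Q h0 t.+1 = hunger_step idx Q h by [].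
have [i chip_i] := chip_exists h x0.
have -> : \sum_(j in A) hunger_step idx Q h j =
    \sum_(j in A) h j + (\sum_(j in A) Q i j - (i \in A)%:R).
  rewrite /hunger_step chip_i /hunger_row big_split /= sumrB; congr (_ + (_ - _)).
  have [iA|/negP iA] := boolP (i \in A).
    rewrite (bigD1 i)//= eqxx big1 ?addr0// => j /andP[_].
    by rewrite eq_sym => /negbTE ->.
  by rewrite big1// => j jA; case: eqP => // ij; case: iA; rewrite ij.
have [Q0 Q1] := sQ.
have QA : \sum_(j in A) Q i j <= 1.
  by rewrite -(Q1 i) [leRHS](bigID (mem A))/= lerDl sumr_ge0.
have [iA|iA] := boolP (i \in A); first by have := IHt A; rewrite /=; lra.
have [->|A0] := eqVneq A finset.set0; first by rewrite !big_set0 cards0 !mul0r /=; lra.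
have k_ge1 : 1 <= #|A|%:R :> R by rewrite ler1n card_gt0.
have h_le : \sum_(j in A) h j <= #|A|%:R * h i.
  rewrite mulr_natl -sumr_const; apply: ler_sum => j _; exact: chip_max.
have := IHt (i |: A)%SET; rewrite big_setU1//= cardsU1 iA /= natrD.
move: (\sum_(j in A) h j) (#|A|%:R) (B + _) (h i) k_ge1 h_le => s k c hi k1 h_le IH.
(* Since [s <= k * hi], [s * (1 + k)] is at most [k * (hi + s)], which [IH] bounds. This gives
   [s <= k * (c - k) - k], and the slack [k >= 1] absorbs the increment. *)
have : s * (1 + k) <= (k * (c - (1 + k))) * (1 + k) by nra.
rewrite ler_pM2r; last by lra.
lra.
Qed.

(** Pairing with the constant 1, which [Q] fixes, makes every firing contribute zero. *)
Lemma hunger_sum h0 t : S -> \sum_j hunger idx Q h0 t j = \sum_j h0 j.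
Proof.
move=> x0; apply/eqP; rewrite -subr_eq0 -sumrB; apply/eqP.
have := firing_pairing h0 t (fun=> 1) x0; under eq_bigr do rewrite mulr1.
move=> ->; rewrite big1// => i _.
by rewrite [transition _ _ _](iter_transition_cst 1 1 i sQ) subrr mulr0.
Qed.

(** The bound on sums over a singleton bounds each entry from above. Applied to the complement of
    [j], together with the conserved total, it bounds entry [j] from below. *)
Lemma hunger_bounded h0 : S -> exists B : R, forall t j, `|hunger idx Q h0 t j| <= B.
Proof.
move=> x0; pose B := \sum_j `|h0 j|.
have h0B j : h0 j <= B.
  by rewrite (le_trans (ler_norm _))// /B (bigD1 j)//= lerDl sumr_ge0.
pose c (k : nat) : R := k%:R * (B + #|S|%:R - k%:R).
exists (`|c 1| + `|\sum_j h0 j| + `|c #|S|.-1|) => t j.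
have := hunger_sum_le t x0 h0B [set j]%SET.
rewrite big_set1 cards1 -/(c 1) => le1.
have := hunger_sum_le t x0 h0B [set~ j]%SET.
rewrite cardsC1 -/(c _) => leC.
have := hunger_sum h0 t x0; rewrite (bigD1 j)//=.
rewrite (eq_bigl (fun i => i \in [set~ j]%SET)); last by move=> i; rewrite !inE.
move: leC; set sC := \sum_(_ in _) _ => leC sum_h.
have := ler_norm (c 1); have := ler_norm (- \sum_j h0 j); rewrite normrN.
have := ler_norm (c #|S|.-1).
have := normr_ge0 (c 1); have := normr_ge0 (\sum_j h0 j).
have := normr_ge0 (c #|S|.-1).
by move=> *; rewrite ler_norml; apply/andP; split; lra.
Qed.

Lemma firing_vector_sum h0 N : S -> (\sum_i firing_vector idx Q h0 N i = N)%N.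
Proof.
move=> x0; rewrite /firing_vector exchange_big /= -[RHS]card_ord -sum1_card.
apply: eq_bigr => t _; have [i ->] := chip_exists (hunger idx Q h0 t) x0.
rewrite (bigD1 i)//= eqxx big1// => j /negbTE ji.
by rewrite eq_sym (inj_eq Some_inj) ji.
Qed.

End Hunger.

(** * Law of the chain and the hitting probability as a limit of marginals *)

Section Law.
Variables (R : realType) (V : finType) (P : V -> V -> R) (v : V).
Variables (d : measure_display) (Omega : measurableType d).
Variables (Pr : probability Omega R) (X : nat -> Omega -> V).

Fixpoint marginal (n : nat) : V -> R :=
  if n is m.+1 then fun y => \sum_z marginal m z * P z y
  else fun y => (y == v)%:R.

(** Duality: pushing the point mass at [v] forward [n] steps amounts to pulling [phi] back [n]
    steps. *)
Lemma marginal_transition n (phi : V -> R) :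
  \sum_y marginal n y * phi y = iter n (transition P) phi v.
Proof.
elim: n phi => [|n IHn] phi /=.
  rewrite (bigD1 v)//= eqxx mul1r big1 ?addr0// => y /negbTE ->.
  by rewrite mul0r.
rewrite -iterS iterSr -IHn; under eq_bigr do rewrite mulr_suml.
rewrite exchange_big; apply: eq_bigr => z _ /=.
by rewrite mulr_sumr; apply: eq_bigr => y _; rewrite mulrA.
Qed.

Lemma marginalE n y :
  marginal n y = iter n (transition P) (fun z => (z \in pred1 y)%:R) v.
Proof.
rewrite -marginal_transition (bigD1 y)//= inE eqxx mulr1.
by rewrite big1 ?addr0// => z /negbTE zy; rewrite inE zy mulr0.
Qed.

Hypothesis hX : markov_chain_from P v Pr X.

Lemma window_measurable n t (x : nat -> V) :
  measurable [set w | forall s, (n <= s <= t)%N -> X s w = x s].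
Proof.
have -> : [set w | forall s, (n <= s <= t)%N -> X s w = x s] =
    \bigcap_(s in [set s | (n <= s <= t)%N]) (X s @^-1` [set x s]).
  by apply/seteqP; split=> w /= h s; apply: h.
by apply: bigcap_measurableType => s _; apply: hX.1.
Qed.

(** The hypothesis on [X] prescribes only trajectories from time 0. Induction on [n] drops the
    earliest time by splitting the event disjointly over the state occupied then. *)
Lemma window_probability n t (x : nat -> V) : (n <= t)%N ->
  Pr [set w | forall s, (n <= s <= t)%N -> X s w = x s] =
  (marginal n (x n) * \prod_(n <= s < t) P (x s) (x s.+1))%:E.
Proof.
elim: n x => [|n IHn] x le_nt; first by rewrite big_mkord -hX.2.
pose x' y s := if s == n then y else x s.
pose W y := [set w | forall s, (n <= s <= t)%N -> X s w = x' y s].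
have -> : [set w | forall s, (n < s <= t)%N -> X s w = x s] =
    \bigcup_(y in [set` index_enum V]) W y.
  apply/seteqP; split => [w h|w [y _ h] s /andP[ns st]].
    exists (X n w); first exact: mem_index_enum.
    move=> s /andP[ns st]; rewrite /x'; case: eqP => [->//|/eqP ne].
    by apply: h; rewrite ltn_neqAle eq_sym ne ns.
  by have := h s; rewrite (ltnW ns) st /x' gtn_eqF// => ->.
rewrite measure_fin_bigcup//; last 2 first.
- move=> y z _ _ [w [Wy Wz]].
  have := Wy n; have := Wz n; rewrite leqnn (ltnW le_nt) /x' eqxx.
  by move=> <-// <-.
- by move=> y _; apply: window_measurable.
rewrite -fsbig_seq ?index_enum_uniq//.
rewrite (eq_bigr _ (fun y _ => IHn (x' y) (ltnW le_nt))).
rewrite sumEFin /= mulr_suml; congr _%:E; apply: eq_bigr => y _.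
rewrite big_ltn// /x' eqxx gtn_eqF// mulrA; congr (_ * _).
by rewrite !big_nat; apply: eq_bigr => s /andP[ns _]; rewrite !gtn_eqF// ltnW.
Qed.

Lemma marginal_probability n y : Pr (X n @^-1` [set y]) = (marginal n y)%:E.
Proof.
have := @window_probability n n (fun=> y) (leqnn n).
rewrite big_geq// mulr1 => <-; congr (Pr _); apply/seteqP; split=> w /=.
  by move=> Xn s; rewrite -eqn_leq => /eqP <-.
by apply; rewrite leqnn.
Qed.

(** As [P u u = 1], being at [u] at times [n] and [n.+1] is as likely as being there at time [n]. *)
Lemma leave_absorbing_negligible n u : stochastic P -> is_absorbing P u ->
  Pr (X n @^-1` [set u] `\` X n.+1 @^-1` [set u]) = 0%E.
Proof.
move=> sP au; have mX t : measurable (X t @^-1` [set u]) by apply: hX.1.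
have stay : Pr (X n @^-1` [set u] `&` X n.+1 @^-1` [set u]) = (marginal n u)%:E.
  have := @window_probability n n.+1 (fun=> u) (leqnSn n).
  rewrite big_nat1 (eqP au) mulr1 => <-; congr (Pr _); apply/seteqP; split=> w /=.
    move=> [Xn Xn1] s /andP[]; rewrite leq_eqVlt => /orP[/eqP <-//|ns sn].
    by have /eqP -> : s == n.+1 by rewrite eqn_leq sn.
  by move=> h; split; apply: h; rewrite !leqnn leqnSn.
have : (marginal n u)%:E = (Pr (X n @^-1` [set u] `\` X n.+1 @^-1` [set u]) +
    (marginal n u)%:E)%E.
  by rewrite -{2}stay -marginal_probability; apply: measureDI.
(* Cancellation in the extended reals requires [p] to be finite. *)
set p := Pr _; have : p \is a fin_num by apply: fin_num_measure; apply: measurableD.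
by case: p => //= p _; rewrite -EFinD => -[p0]; congr _%:E; lra.
Qed.

(** A trajectory at [u] at time [n] that does not remain there must leave [u] at some step, and a
    countable union of null events is null. *)
Lemma eventually_absorbed_probability n u : stochastic P -> is_absorbing P u ->
  Pr (\bigcap_(t in [set t | (n <= t)%N]) X t @^-1` [set u]) = (marginal n u)%:E.
Proof.
move=> sP au; have mX t : measurable (X t @^-1` [set u]) by apply: hX.1.
set E := \bigcap_(_ in _) _.
have mE : measurable E by apply: bigcap_measurableType.
have EX : E `<=` X n @^-1` [set u] by move=> w; apply => /=.
have XE0 : Pr (X n @^-1` [set u] `\` E) = 0%E.
  apply: measure_negligible; first exact: measurableD.
  apply: (@negligibleS _ _ _ _ (\bigcup_t (X t @^-1` [set u] `\` X t.+1 @^-1` [set u]))).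
    move=> w [/= Xn nE]; apply: contrapT => never; apply: nE => t /= /subnK <-.
    elim: (t - n)%N => // k Xk; apply: contrapT => nXk.
    by apply: never; exists (k + n)%N.
  apply: negligible_bigcup => t; apply/negligibleP; first exact: measurableD.
  exact: leave_absorbing_negligible.
rewrite -marginal_probability -[LHS]add0e -XE0 -{2}(setIidr EX).
exact/esym/measureDI.
Qed.

(** The event of ending at [u] is the increasing union of the events [E n], so continuity from below
    applies. *)
Lemma marginal_cvg_hitting u : stochastic P -> is_absorbing P u ->
  marginal n u @[n --> \oo] --> hitting_probability Pr X u.
Proof.
move=> sP au; have mX t : measurable (X t @^-1` [set u]) by apply: hX.1.
pose E n := \bigcap_(t in [set t | (n <= t)%N]) X t @^-1` [set u].
have mE n : measurable (E n) by apply: bigcap_measurableType.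
have -> : hitting_probability Pr X u = fine (Pr (\bigcup_n E n)).
  congr (fine (Pr _)); apply/seteqP; split=> w /= [n _ h]; exists n => //.
have homoE : {homo E : m n / (m <= n)%O >-> (m <= n)%O}.
  move=> m n mn; apply/subsetPset => w h t /= nt.
  by apply: h => /=; apply: leq_trans nt.
suff : (EFin \o (fun n => marginal n u)) n @[n --> \oo] -->
    (fine (Pr (\bigcup_n E n)))%:E by move/fine_cvg.
have -> : EFin \o (fun n => marginal n u) = Pr \o E.
  by apply/funext => n /=; rewrite eventually_absorbed_probability.
rewrite fineK; last by apply: fin_num_measure; apply: bigcupT_measurable.
exact: (nondecreasing_cvg_mu mE (bigcupT_measurable _ mE) homoE).
Qed.

End Law.

(** * The rerouted chain and its restriction to reachable states *)

Section Rerouting.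
Variables (R : realType) (V : finType) (P : V -> V -> R) (v : V).
Hypothesis sP : stochastic P.

Lemma reroute_stochastic : stochastic (reroute P v).
Proof.
split=> [x y|x]; rewrite /reroute; case: (is_absorbing P x).
- by rewrite ler0n.
- exact: sP.1.
- rewrite (bigD1 v)//= eqxx big1 ?addr0// => y.
  by move=> /negbTE ->.
- exact: sP.2.
Qed.

Lemma sum_rerouted_state (F : V -> R) :
  (forall x, ~~ connect (pos_step (reroute P v)) v x -> F x = 0) ->
  \sum_x F x = \sum_(s : rerouted_state P v) F (val s).
Proof.
move=> F0; rewrite (bigID (connect (pos_step (reroute P v)) v))/=.
rewrite [X in _ + X]big1 ?addr0//.
rewrite (reindex_omap (fun s : rerouted_state P v => val s) insub); last first.
  by move=> x cx; rewrite insubT.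
by apply: eq_bigl => s; rewrite valK eqxx andbT; apply: valP.
Qed.

(** A reachable state gives no weight to unreachable ones, so deleting them leaves the sum
    unchanged. *)
Lemma transition_rerouted (phi : V -> R) (i : rerouted_state P v) :
  transition (@rerouted R V P v) (phi \o val) i = transition (reroute P v) phi (val i).
Proof.
rewrite /transition sum_rerouted_state// => y /negP ny.
suff /eqP -> : reroute P v (val i) y == 0 by rewrite mul0r.
rewrite eq_le reroute_stochastic.1 andbT leNgt; apply/negP => Py.
by apply: ny; apply: connect_trans (valP i) (connect1 Py).
Qed.

Lemma rerouted_stochastic : stochastic (@rerouted R V P v).
Proof.
split=> [x y|x]; first exact: reroute_stochastic.1.
rewrite -[RHS](reroute_stochastic.2 (val x)).
have := transition_rerouted (fun=> 1) x; rewrite /transition /=.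
by under eq_bigr do rewrite mulr1; under [RHS]eq_bigr do rewrite mulr1.
Qed.

Lemma transition_reroute (phi : V -> R) x : transition (reroute P v) phi x =
  if is_absorbing P x then phi v else transition P phi x.
Proof.
rewrite /transition /reroute; case: (is_absorbing P x) => //.
rewrite (bigD1 v)//= eqxx mul1r big1 ?addr0// => y /negbTE ->.
by rewrite mul0r.
Qed.

Lemma rerouted_firing_val idx h0 N (s : rerouted_state P v) :
  rerouted_firing idx h0 N (val s) = firing_vector idx (@rerouted R V P v) h0 N s.
Proof. by rewrite /rerouted_firing valK. Qed.

Lemma sum_rerouted_firing idx h0 N (F : V -> R) :
  \sum_(s : rerouted_state P v)
    (firing_vector idx (@rerouted R V P v) h0 N s)%:R * F (val s) =
  \sum_x (rerouted_firing idx h0 N x)%:R * F x.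
Proof.
rewrite sum_rerouted_state => [|x nx]; last by rewrite /rerouted_firing insubN// mul0r.
by apply: eq_bigr => s _; rewrite rerouted_firing_val.
Qed.

Lemma rerouted_pairing_bounded idx h0 (phi : V -> R) : exists M : R, forall N,
  `|\sum_x (rerouted_firing (P := P) (v := v) idx h0 N x)%:R * (transition (reroute P v) phi x - phi x)|
  <= M.
Proof.
have v0 : rerouted_state P v by exists v; apply: connect0.
have [B hB] := hunger_bounded idx rerouted_stochastic h0 v0.
exists (\sum_(j : rerouted_state P v) (B + `|h0 j|) * `|phi (val j)|) => N.
rewrite -sum_rerouted_firing; under eq_bigr do rewrite -transition_rerouted.
rewrite -(firing_pairing idx (@rerouted R V P v) h0 N (phi \o val) v0).
apply: le_trans (ler_norm_sum _ _ _) _; apply: ler_sum => j _.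
rewrite normrM ler_wpM2r// (le_trans (ler_normB _ _))// lerD2r.
exact: hB.
Qed.

Lemma sum_rerouted_firing_total idx h0 N :
  \sum_x (rerouted_firing (P := P) (v := v) idx h0 N x)%:R = N%:R :> R.
Proof.
have v0 : rerouted_state P v by exists v; apply: connect0.
rewrite -[in RHS](firing_vector_sum idx (@rerouted R V P v) h0 N v0) natr_sum.
by have := sum_rerouted_firing idx h0 N (fun=> 1); rewrite -!mulr_suml !mulr1.
Qed.

End Rerouting.

Theorem theorem6p3 (R : realType) (V : finType) (P : V -> V -> R)
  (hP : absorbing_chain P)
  (v u : V) (hv : ~~ is_absorbing P v) (hu : is_absorbing P u)
  (d : measure_display) (Omega : measurableType d)
  (Pr : probability Omega R) (X : nat -> Omega -> V)
  (hX : markov_chain_from P v Pr X)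
  (idx : rerouted_state P v -> nat) (hidx : injective idx)
  (h0 : rerouted_state P v -> R) :
  (absorption_ratio idx h0 u N @[N --> \oo] --> hitting_probability Pr X u) /\
  exists C : R, forall N : nat, (1 <= N)%N ->
    `|absorption_ratio idx h0 u N - hitting_probability Pr X u| <= C / N%:R.
Proof.
have [sP _] := hP.
have su : {subset pred1 u <= is_absorbing P} by move=> x; rewrite inE => /eqP ->.
have [g [g_cvg g01 g_abs g_harm]] := harmonic_limit sP su.
(* Both are limits of the same sequence of marginals at [u]. *)
have -> : hitting_probability Pr X u = g v.
  have := @marginal_cvg_hitting _ _ _ _ _ _ _ _ hX u sP hu.
  under eq_fun do rewrite marginalE.
  by move=> h; apply: cvg_unique h (g_cvg v).
have [tau [tau0 tau_abs tau_drift]] := lyapunov_exists hP.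
have [M hM] := rerouted_pairing_bounded sP idx h0 g.
have [C hC] := rerouted_pairing_bounded sP idx h0 tau.
pose f N x : R := (rerouted_firing idx h0 N x)%:R.
pose D N := \sum_(x | is_absorbing P x) f N x.
have f_ge0 N x : 0 <= f N x by rewrite ler0n.
have D_ge0 N : 0 <= D N by apply: sumr_ge0.
have fD N : f N u <= D N by rewrite /D (bigD1 u)//= lerDl sumr_ge0.
have ratioE N : absorption_ratio idx h0 u N = f N u / D N.
  by rewrite /absorption_ratio /D /f natr_sum.
have ratio01 N : 0 <= f N u / D N <= 1.
  rewrite divr_ge0//=; have [->|D0] := eqVneq (D N) 0; first by rewrite invr0 mulr0 ler01.
  by rewrite ler_pdivrMr ?mul1r ?fD// lt_def D0 D_ge0.
(* Off the absorbing states [g] contributes nothing; at an absorbing [x] the factor is [g v] minus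
   the indicator of [x = u]. *)
have ratio_bound N : D N * `|f N u / D N - g v| <= M.
  apply: le_trans (hM N); rewrite -{1}(ger0_norm (D_ge0 N)) -normrM.
  suff -> : D N * (f N u / D N - g v) = - \sum_x
      (rerouted_firing idx h0 N x)%:R * (transition (reroute P v) g x - g x).
    by rewrite normrN lexx.
  rewrite [\sum_x _](bigID (is_absorbing P))/= [X in - (_ + X)]big1 ?addr0; last first.
    by move=> x /negbTE nx; rewrite transition_reroute nx g_harm subrr mulr0.
  under eq_bigr => x ax do rewrite transition_reroute ax (g_abs x ax) inE mulrBr.
  rewrite sumrB -mulr_suml -/(D N) (bigD1 u)//= eqxx mulr1 big1 ?addr0; last first.
    by move=> x /andP[_ /negbTE ->]; rewrite mulr0.
  rewrite -/(f N u) mulrBr opprB; congr (_ - _).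
  (* If [D N] is zero, so is [f N u], and the identity survives the default value of the
     quotient. *)
  have [D0|D0] := eqVneq (D N) 0; last by rewrite mulrC divfK.
  rewrite D0 mul0r; apply/eqP; rewrite eq_le f_ge0 /=.
  by rewrite -[leRHS]D0 fD.
(* The factor of [tau] is [(1 + tau v) - 1] at absorbing states and at most -1 elsewhere, while the
   firings total [N]. *)
have count_bound N : N%:R <= C + (1 + tau v) * D N.
  have := le_trans (ler_norm _) (hC N).
  have := ler_norm
    (- \sum_x f N x * (transition (reroute P v) tau x - tau x)).
  rewrite normrN => /le_trans/(_ (hC N)) + _.
  have : \sum_x f N x * (transition (reroute P v) tau x - tau x) <=
      \sum_x f N x * ((is_absorbing P x)%:R * (1 + tau v) - 1).
    apply: ler_sum => x _; rewrite ler_wpM2l// transition_reroute.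
    case: (boolP (is_absorbing P x)) => ax; first by rewrite (tau_abs x ax) mul1r; lra.
    by have := tau_drift x ax; rewrite mul0r; lra.
  under [leRHS]eq_bigr do rewrite mulrBr mulr1 mulrA.
  rewrite sumrB sum_rerouted_firing_total -mulr_suml.
  have -> : \sum_x f N x * (is_absorbing P x)%:R = D N.
    rewrite /D [RHS]big_mkcond; apply: eq_bigr => x _.
    by case: ifP => _; rewrite ?mulr1 ?mulr0.
  lra.
have C0 : 0 <= C := le_trans (normr_ge0 _) (hC 0%N).
have rate N : (1 <= N)%N -> `|absorption_ratio idx h0 u N - g v| <=
    (C + (1 + tau v) * M) / N%:R.
  move=> N1; rewrite ler_pdivlMr ?ltr0n// ratioE mulrC.
  (* Multiplying [count_bound] by the error [e] leaves [C * e], at most [C] because [e <= 1], and a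
     term in [D N * e], controlled by [ratio_bound]. *)
  set e : R := `|_|; have e0 : 0 <= e by exact: normr_ge0.
  have e1 : e <= 1.
    by have := ratio01 N; have := g01 v; rewrite ler_norml => *; apply/andP; split; lra.
  have : N%:R * e <= (C + (1 + tau v) * D N) * e by rewrite ler_wpM2r// count_bound.
  have : (1 + tau v) * (D N * e) <= (1 + tau v) * M.
    by rewrite ler_wpM2l// ?ratio_bound// addr_ge0.
  nra.
split; last by exists (C + (1 + tau v) * M).
set K := C + _ in rate.
have K0 : K / N%:R @[N --> \oo] --> (0 : R).
  rewrite -[X in _ --> X](mulr0 K); apply: cvgM; first exact: cvg_cst.
  (* The harmonic sequence is indexed as [1 / (N + 1)], hence the shift. *)
  by rewrite -(cvg_shiftS (fun N => N%:R^-1 : R)); exact: cvg_harmonic.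
apply: (@squeeze_cvgr _ _ _ _ (fun N => g v - K / N%:R) (fun N => g v + K / N%:R)).
- near=> N; rewrite -ler_distl; apply: rate.
  by near: N; exact: nbhs_infty_ge.
- by rewrite -[X in _ --> X]subr0; apply: cvgB; [exact: cvg_cst|exact: K0].
- by rewrite -[X in _ --> X]addr0; apply: cvgD; [exact: cvg_cst|exact: K0].
Unshelve. all: by end_near. Qed.
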